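(* Let $E$ be a Banach space and $X,Y\in\mathrm{Age}(E)$. Then: (1) $\gamma_E^a(X,Y)\le\gamma_E(X,Y)\le D_E(X,Y)$ and $\gamma_E^a(X,Y)\le D_E^a(X,Y)\le D_E(X,Y)$. (2) If $E$ is almost ultrahomogeneous, then $\gamma_E^a(X,Y)\le D_E^a(X,Y)\le\gamma_E(X,Y)\le D_E(X,Y)$. (3) If $E$ is weak almost Fra\''iss\'e, then $\gamma_E^a(X,Y)=D_E^a(X,Y)\le\gamma_E(X,Y)\le D_E(X,Y)$, and in particular $\gamma_E^a$ is a pseudometric on $\mathrm{Age}(E)$. (4) If $E$ is approximately ultrahomogeneous, then $\gamma_E^a(X,Y)\le D_E^a(X,Y)\le\gamma_E(X,Y)=D_E(X,Y)$, and in particular $\gamma_E$ is a pseudometric on $\mathrm{Age}(E)$. (5) If $E$ is weak Fra\''iss\'e, then the four maps $\gamma_E^a,\gamma_E,D_E^a,D_E$ coincide on $\mathrm{Age}(E)^2$.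
   Context: For Banach spaces $X,E$ and $\delta\ge 0$, a $\delta$-isometry from $X$ to $E$ is a linear map $T\colon X\to E$ with $\frac{1}{1+\delta}\|x\|\le\|Tx\|\le(1+\delta)\|x\|$ for all $x\in X$. $\mathrm{Emb}(X,E)$ (resp. $\mathrm{Emb}_\delta(X,E)$) is the set of linear isometries (resp. $\delta$-isometries) from $X$ into $E$; $\mathrm{Isom}(E)$ (resp. $\mathrm{Isom}_\delta(E)$) is the set of surjective linear isometries (resp. surjective $\delta$-isometries) from $E$ onto $E$. $\mathrm{Age}(E)$ is the set of finite-dimensional subspaces of $E$. $B_X$ is the closed unit ball of $X$, $d_H$ is the Hausdorff distance on subsets of $E$ induced by the norm of $E$, and $X_0\equiv X$ means $X_0$ is linearly isometric to $X$. For $X,Y\in\mathrm{Age}(E)$: $\gamma_E(X,Y)=\inf\{d_H(B_{X_0},B_{Y_0}): X_0,Y_0\in\mathrm{Age}(E),\ X_0\equiv X,\ Y_0\equiv Y\}$; $D_E(X,Y)=\inf\{d_H(B_{TX},B_Y): T\in\mathrm{Isom}(E)\}$; $D_\delta(X,Y)=\inf\{d_H(T(B_X),U(B_Y)): T,U\in\mathrm{Isom}_\delta(E)\}$ and $D_E^a(X,Y)=\lim_{\delta\to0}D_\delta(X,Y)=\sup_{\delta>0}D_\delta(X,Y)$; $d_\delta(X,Y)=\inf\{d_H(t(B_X),t'(B_Y)): t\in\mathrm{Emb}_\delta(X,E),\ t'\in\mathrm{Emb}_\delta(Y,E)\}$ and $\gamma_E^a(X,Y)=\lim_{\delta\to0}d_\delta(X,Y)=\sup_{\delta>0}d_\delta(X,Y)$.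 $E$ is almost ultrahomogeneous if for all $\varepsilon>0$, $X\in\mathrm{Age}(E)$ and $\phi\in\mathrm{Emb}(X,E)$ there is $T\in\mathrm{Isom}_\varepsilon(E)$ with $T|_X=\phi$. $E$ is approximately ultrahomogeneous if for all $\varepsilon>0$, $X\in\mathrm{Age}(E)$ and $\phi,\psi\in\mathrm{Emb}(X,E)$ there is $T\in\mathrm{Isom}(E)$ with $\|T\circ\phi-\psi\|<\varepsilon$. $E$ is weak almost Fra\''iss\'e if for every $X\in\mathrm{Age}(E)$ and $\varepsilon>0$ there is $\delta>0$ such that for every $\phi\in\mathrm{Emb}_\delta(X,E)$ there is $T\in\mathrm{Isom}_\varepsilon(E)$ with $T|_X=\phi$. $E$ is weak Fra\''iss\'e if for every $\varepsilon>0$ and $X\in\mathrm{Age}(E)$ there is $\delta>0$ such that for all $\phi,\psi\in\mathrm{Emb}_\delta(X,E)$ there is $T\in\mathrm{Isom}(E)$ with $\|T\circ\phi-\psi\|<\varepsilon$. *)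

(* Defs.v *)
From HB Require Import structures.
From mathcomp Require Import all_boot all_order all_algebra.
From mathcomp Require Import complex.
From mathcomp Require Import all_classical all_reals all_analysis.

Set Implicit Arguments.
Unset Strict Implicit.
Unset Printing Implicit Defensive.

Import Order.TTheory GRing.Theory Num.Theory.
Import numFieldNormedType.Exports.

Local Open Scope classical_set_scope.
Local Open Scope ring_scope.

(* Banach spaces are taken over either of the two usual scalar fields: the reals
   R, or the complex numbers R[i]. *)
Inductive scalar_kind := RealScalars | ComplexScalars.

Definition scalars (R : realType) (k : scalar_kind) : numFieldType :=
  match k with
  | RealScalars => R : numFieldType
  | ComplexScalars => complex R : numFieldType
  end.

Definition scalar_Re (R : realType) (k : scalar_kind) : scalars R k -> R :=
  match k return scalars R k -> R with
  | RealScalars => fun a => a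
  | ComplexScalars => fun a => complex.Re a
  end.

(* The library's norm on a module over K takes values in K, so for complex
   scalars it is a (real) element of R[i]; rnorm is that norm read in R. *)
Definition rnorm (R : realType) (k : scalar_kind)
  (E : normedModType (scalars R k)) (x : E) : R := @scalar_Re R k `|x|.

Section GeometryOfBanachSpace.
Context (R : realType) (k : scalar_kind).
Context (E : completeNormedModType (scalars R k)).
Implicit Types (A B X Y : set E) (f t u phi psi T U : E -> E) (d e : R).

Definition Age : set (set E) :=
  [set X | exists n (b : 'I_n -> E),
     X = [set x | exists c : 'I_n -> scalars R k, x = \sum_(i < n) c i *: b i]].

Definition unit_ball X : set E := X `&` [set x | rnorm x <= 1].

(* Maps X -> E are represented by functions E -> E whose values outside X are
   irrelevant: every notion below only looks at their restriction to X. *)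
Definition linear_on X f : Prop :=
  forall (a : scalars R k) x y, X x -> X y -> f (a *: x + y) = a *: f x + f y.

Definition Emb X : set (E -> E) :=
  [set f | linear_on X f /\ forall x, X x -> rnorm (f x) = rnorm x].

Definition Emb_delta d X : set (E -> E) :=
  [set f | linear_on X f /\
     forall x, X x ->
       (1 + d)^-1 * rnorm x <= rnorm (f x) <= (1 + d) * rnorm x].

Definition Isom : set (E -> E) :=
  [set T | Emb setT T /\ T @` setT = setT].

Definition Isom_delta d : set (E -> E) :=
  [set T | Emb_delta d setT T /\ T @` setT = setT].

Definition isometric_to X0 X : Prop := exists2 f, Emb X f & f @` X = X0.

Local Open Scope ereal_scope.

(* Hausdorff distance; it is real-valued on nonempty bounded sets. *)
Definition dist_to_set B (x : E) : \bar R :=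
  ereal_inf [set (rnorm (x - y)%R)%:E | y in B].

Definition hausdorff_dist A B : \bar R :=
  maxe (ereal_sup [set dist_to_set B x | x in A])
       (ereal_sup [set dist_to_set A y | y in B]).

Definition gamma X Y : \bar R :=
  ereal_inf [set hausdorff_dist (unit_ball X0) (unit_ball Y0) |
    X0 in [set X0 | Age X0 /\ isometric_to X0 X] &
    Y0 in [set Y0 | Age Y0 /\ isometric_to Y0 Y]].

Definition DE X Y : \bar R :=
  ereal_inf [set hausdorff_dist (unit_ball (T @` X)) (unit_ball Y) |
    T in Isom].

Definition D_delta d X Y : \bar R :=
  ereal_inf [set hausdorff_dist (T @` unit_ball X) (U @` unit_ball Y) |
    T in Isom_delta d & U in Isom_delta d].

Definition DE_a X Y : \bar R :=
  ereal_sup [set D_delta d X Y | d in [set d | (0 < d)%R]].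

Definition d_delta d X Y : \bar R :=
  ereal_inf [set hausdorff_dist (t @` unit_ball X) (u @` unit_ball Y) |
    t in Emb_delta d X & u in Emb_delta d Y].

Definition gamma_a X Y : \bar R :=
  ereal_sup [set d_delta d X Y | d in [set d | (0 < d)%R]].

(* Operator norm of the difference of two maps defined on X. *)
Definition opdist X f g : \bar R :=
  ereal_sup [set (rnorm (f x - g x)%R)%:E | x in unit_ball X].

Definition almost_ultrahomogeneous : Prop :=
  forall e X phi, (0 < e)%R -> Age X -> Emb X phi ->
    exists2 T, Isom_delta e T & forall x, X x -> T x = phi x.

Definition approximately_ultrahomogeneous : Prop :=
  forall e X phi psi, (0 < e)%R -> Age X -> Emb X phi -> Emb X psi ->
    exists2 T, Isom T & opdist X (T \o phi) psi < e%:E.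

Definition weak_almost_Fraisse : Prop :=
  forall X e, Age X -> (0 < e)%R ->
    exists2 d, (0 < d)%R &
      forall phi, Emb_delta d X phi ->
        exists2 T, Isom_delta e T & forall x, X x -> T x = phi x.

Definition weak_Fraisse : Prop :=
  forall e X, (0 < e)%R -> Age X ->
    exists2 d, (0 < d)%R &
      forall phi psi, Emb_delta d X phi -> Emb_delta d X psi ->
        exists2 T, Isom T & opdist X (T \o phi) psi < e%:E.

End GeometryOfBanachSpace.

Arguments Age {R k} E.
Arguments almost_ultrahomogeneous {R k} E.
Arguments approximately_ultrahomogeneous {R k} E.
Arguments weak_almost_Fraisse {R k} E.
Arguments weak_Fraisse {R k} E.

Definition pseudometric_on (R : realType) (S : Type) (A : set S)
    (rho : S -> S -> \bar R) : Prop :=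
  [/\ forall x y, A x -> A y -> rho x y \is a fin_num /\ (0 <= rho x y)%E,
      forall x, A x -> rho x x = 0%E,
      forall x y, A x -> A y -> rho x y = rho y x
    & forall x y z, A x -> A y -> A z -> (rho x z <= rho x y + rho y z)%E].

(* Main.v *)
(* The infima gamma, DE, D_delta and d_delta range over pairs of maps t on X and
   u on Y taken from nested classes, which gives all the inequalities of (1).
   The reverse inequalities come from replacing t and u by better maps:
   extending them to elements of Isom_delta leaves the images of the unit balls
   unchanged, and approximating them within e by surjective isometries moves
   these images by at most e in Hausdorff distance. The triangle inequality is
   clear for DE and DE_a: Hausdorff closeness can be transported by an element of
   Isom_delta d at the cost of a factor 1 + d. *)
Require Import Defs.
From HB Require Import structures.
From mathcomp Require Import all_boot all_order all_algebra.
From mathcomp Require Import ring lra complex.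
From mathcomp Require Import all_classical all_reals all_analysis.

Set Implicit Arguments.
Unset Strict Implicit.
Unset Printing Implicit Defensive.

Import Order.TTheory GRing.Theory Num.Theory.
Import numFieldNormedType.Exports.

Local Open Scope classical_set_scope.
Local Open Scope ring_scope.
Local Open Scope ereal_scope.


(** * The real-valued norm, uniformly for real and complex scalars *)

Section RealNorm.
Context (R : realType) (k : scalar_kind).

Lemma scalar_ReD (a b : scalars R k) :
  (scalar_Re (a + b) = scalar_Re a + scalar_Re b)%R.
Proof. by case: k a b => //= -[a1 a2] [b1 b2]. Qed.

Lemma ler_scalar_Re (a b : scalars R k) :
  (a <= b -> scalar_Re a <= scalar_Re b)%R.
Proof. by case: k a b => //= a b; rewrite lecE => /andP[]. Qed.

Lemma scalar_Re0 : scalar_Re (0 : scalars R k)%R = 0%R.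
Proof. by case: k. Qed.

(** In the complex case [0 <= a] already forces the imaginary part to vanish, so the real part
    determines [a]. *)
Lemma scalar_Re_eq0 (a : scalars R k) :
  (0 <= a -> scalar_Re a = 0 -> a = 0)%R.
Proof.
case: k a => //= -[x y]; rewrite lecE /= => /andP[/eqP -> _] ->.
by [].
Qed.

Context (E : normedModType (scalars R k)).
Implicit Types x y z : E.

Lemma rnorm_ge0 x : (0 <= rnorm x)%R.
Proof. by rewrite -scalar_Re0; exact: ler_scalar_Re. Qed.

Lemma rnorm0 : rnorm (0 : E)%R = 0%R.
Proof. by rewrite /rnorm normr0 scalar_Re0. Qed.

Lemma rnorm0_eq0 x : rnorm x = 0%R -> x = 0%R.
Proof. by move=> /scalar_Re_eq0 x0; apply/normr0_eq0/x0. Qed.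

Lemma rdistC x y : rnorm (x - y)%R = rnorm (y - x)%R.
Proof. by rewrite /rnorm distrC. Qed.

Lemma rdist_triangle y x z : (rnorm (x - z) <= rnorm (x - y) + rnorm (y - z))%R.
Proof. by rewrite -scalar_ReD; apply/ler_scalar_Re/ler_distD. Qed.

End RealNorm.

(** Turns a comparison of infima into a transport of witnesses: a real [r] strictly above the
    infimum [y] yields a pair of maps realising [r], and only that pair has to be converted. *)
Lemma lee_real_gt (R : realType) (x y : \bar R) :
  (forall r : R, y < r%:E -> x <= r%:E) -> x <= y.
Proof.
case: y => [y| |] xy; last 2 first.
- by rewrite leey.
(* For [y] equal to [-oo] every real is admissible, so a finite [x] is refuted by [x - 1] and [+oo]
   by 0. *)
- case: x xy => [x| |] xy //.
  + by have := xy (x - 1)%R (ltNyr _); rewrite lee_fin lerDl oppr_ge0 ler10.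
  + by have := xy 0%R (ltNyr _).
- apply/lee_addgt0Pr => e e0; rewrite -EFinD; apply: xy.
  by rewrite lte_fin ltrDl.
Qed.

(** * Hausdorff distance and its attained form *)

Section Hausdorff.
Context (R : realType) (k : scalar_kind).
Context (E : completeNormedModType (scalars R k)).
Implicit Types (A B C : set E) (f g : E -> E) (r s c : R).

(** Closeness with actual points instead of infima, so that it passes directly through maps. It lies
    between Hausdorff distance below [r] and Hausdorff distance at most [r], by [hausdorff_dist_lt]
    and [hausdorff_dist_le]. *)
Definition hclose r A B : Prop :=
  (forall x, A x -> exists2 y, B y & (rnorm (x - y) <= r)%R) /\
  (forall y, B y -> exists2 x, A x & (rnorm (x - y) <= r)%R).

Lemma hclose_sym r A B : hclose r A B -> hclose r B A.
Proof.
by move=> [AB BA]; split=> x; [move/BA|move/AB] => -[y ? ?]; exists y; rewrite // rdistC.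
Qed.

Lemma hclose_trans r s A B C :
  hclose r A B -> hclose s B C -> hclose (r + s) A C.
Proof.
move=> [AB BA] [BC CB]; split=> x.
  move=> /AB[y /BC[z Cz yz] xy]; exists z => //.
  exact: le_trans (rdist_triangle y _ _) (lerD xy yz).
move=> /CB[y /BA[z Az zy] yx]; exists z => //.
exact: le_trans (rdist_triangle y _ _) (lerD zy yx).
Qed.

Lemma hclose_lipschitz c r f A B :
  (0 <= c)%R -> (forall x y, rnorm (f x - f y) <= c * rnorm (x - y))%R ->
  hclose r A B -> hclose (c * r) (f @` A) (f @` B).
Proof.
move=> c0 fc [AB BA]; split=> _ [x + <-].
  move=> /AB[y By xy]; exists (f y); first by exists y.
  by apply: le_trans (fc _ _) _; rewrite ler_wpM2l.
move=> /BA[y Ay xy]; exists (f y); first by exists y.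
by apply: le_trans (fc _ _) _; rewrite ler_wpM2l.
Qed.

Lemma hclose_image r f g A :
  (forall x, A x -> rnorm (f x - g x) <= r)%R -> hclose r (f @` A) (g @` A).
Proof.
by move=> fg; split=> _ [x Ax <-]; [exists (g x)|exists (f x)]; by [exists x|exact: fg].
Qed.

(** The infimum in [dist_to_set] may fail to be attained; the strict bound is what supplies a
    point. *)
Lemma hausdorff_dist_lt r A B : hausdorff_dist A B < r%:E -> hclose r A B.
Proof.
rewrite /hausdorff_dist gt_max => /andP[AB BA]; split=> x xA.
  have /ereal_inf_lt[_ [y By <-] yr] : dist_to_set B x < r%:E.
    by apply: le_lt_trans AB; apply: ereal_sup_ubound; exists x.
  by exists y => //; move: yr; rewrite lte_fin => /ltW.
have /ereal_inf_lt[_ [y By <-] yr] : dist_to_set A x < r%:E.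
  by apply: le_lt_trans BA; apply: ereal_sup_ubound; exists x.
by exists y => //; move: yr; rewrite rdistC lte_fin => /ltW.
Qed.

Lemma hausdorff_dist_le r A B : hclose r A B -> hausdorff_dist A B <= r%:E.
Proof.
move=> [AB BA]; rewrite /hausdorff_dist ge_max; apply/andP; split.
  apply: ge_ereal_sup => _ [x /AB[y By xy] <-].
  by apply: ge_ereal_inf; exists (rnorm (x - y)%R)%:E => //; exists y.
apply: ge_ereal_sup => _ [x /BA[y By xy] <-].
by apply: ge_ereal_inf; exists (rnorm (x - y)%R)%:E; [exists y|rewrite rdistC].
Qed.

Lemma hausdorff_distC A B : hausdorff_dist A B = hausdorff_dist B A.
Proof. by rewrite /hausdorff_dist maxC. Qed.

(** The point of [A] keeps the first supremum away from [-oo], its value on the empty set. *)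
Lemma hausdorff_dist_ge0 A B : A !=set0 -> 0 <= hausdorff_dist A B.
Proof.
move=> [x Ax]; rewrite /hausdorff_dist le_max; apply/orP; left.
apply: (@le_trans _ _ (dist_to_set B x)); last by apply: ereal_sup_ubound; exists x.
by apply: le_ereal_inf_tmp => _ [y _ <-]; rewrite lee_fin rnorm_ge0.
Qed.

End Hausdorff.

(** * Isometries and almost isometries, their compositions and inverses *)

Section Maps.
Context (R : realType) (k : scalar_kind).
Context (E : completeNormedModType (scalars R k)).
Implicit Types (X Y Z : set E) (f t u T U : E -> E) (d e r : R).

Lemma Age0 X : Age E X -> X 0%R.
Proof.
move=> [n [b ->]]; exists (fun=> 0%R).
by rewrite big1// => i _; rewrite scale0r.
Qed.

Lemma unit_ball0 X : Age E X -> unit_ball X 0%R.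
Proof. by move=> /Age0; split=> //=; rewrite rnorm0 ler01. Qed.

Lemma linear_on_sub X Y f : Y `<=` X -> linear_on X f -> linear_on Y f.
Proof. by move=> YX lf a x y /YX Xx /YX Xy; exact: lf. Qed.

Lemma linear_on0 X f : X 0%R -> linear_on X f -> f 0%R = 0%R.
Proof.
move=> X0 lf; have := lf 1%R 0%R 0%R X0 X0.
by rewrite !scale1r addr0 -[LHS]addr0 => /addrI.
Qed.

Lemma linear_onB f x y : linear_on setT f -> f (x - y)%R = (f x - f y)%R.
Proof.
by move=> lf; have := lf (-1)%R y x I I; rewrite !scaleN1r ![(- _ + _)%R]addrC.
Qed.

Lemma linear_on_sum f n (c : 'I_n -> scalars R k) (b : 'I_n -> E) :
  linear_on setT f ->
  f (\sum_(i < n) c i *: b i)%R = (\sum_(i < n) c i *: f (b i))%R.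
Proof.
move=> lf; have f0 := linear_on0 I lf.
have fD : {morph f : x y / (x + y)%R}.
  by move=> x y; have := lf 1%R x y I I; rewrite !scale1r.
rewrite (big_morph f fD f0); apply: eq_bigr => i _.
by have := lf (c i) (b i) 0%R I I; rewrite f0 !addr0.
Qed.

Lemma Age_image X f : linear_on setT f -> Age E X -> Age E (f @` X).
Proof.
move=> lf [n [b ->]]; exists n, (f \o b); apply/seteqP; split.
  by move=> _ [_ [c ->] <-]; exists c; exact: linear_on_sum.
by move=> _ [c ->]; exists (\sum_(i < n) c i *: b i)%R; [exists c|exact: linear_on_sum].
Qed.

Lemma Emb_id X : Emb X id.
Proof. by []. Qed.

Lemma Emb_sub X Y f : Y `<=` X -> Emb X f -> Emb Y f.
Proof. by move=> YX [lf nf]; split; [exact: linear_on_sub lf|move=> x /YX/nf]. Qed.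

Lemma Emb_delta_sub d X Y f : Y `<=` X -> Emb_delta d X f -> Emb_delta d Y f.
Proof. by move=> YX [lf nf]; split; [exact: linear_on_sub lf|move=> x /YX/nf]. Qed.

(** A division-free form in which [x] and [f x] play symmetric roles, suited to inverting maps. *)
Lemma Emb_deltaP d X f : (0 <= d)%R -> Emb_delta d X f <->
  linear_on X f /\ forall x, X x ->
    (rnorm x <= (1 + d) * rnorm (f x))%R /\ (rnorm (f x) <= (1 + d) * rnorm x)%R.
Proof.
move=> d0; split=> -[lf nf]; split=> // x /nf.
  by move=> /andP[]; rewrite ler_pdivrMl ?ltr_pwDl.
by move=> [h1 h2]; rewrite ler_pdivrMl ?ltr_pwDl// h1 h2.
Qed.

Lemma Emb_delta_le d e X f : (0 <= d)%R -> (d <= e)%R ->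
  Emb_delta d X f -> Emb_delta e X f.
Proof.
move=> d0 de /(Emb_deltaP _ _ d0)[lf nf]; apply/Emb_deltaP; first exact: le_trans de.
by split=> // x /nf[h1 h2]; split; [apply: le_trans h1 _|apply: le_trans h2 _];
   rewrite ler_wpM2r ?rnorm_ge0// lerD2l.
Qed.

(** Makes isometries the case of parameter 0, so that composition, inverse and Lipschitz bounds are
    proved once for both kinds of maps. *)
Lemma Emb_delta0 X f : Emb_delta 0%R X f <-> Emb X f.
Proof.
rewrite /Emb_delta /Emb /= addr0 invr1; split=> -[lf nf]; split=> // x /nf; rewrite mul1r.
  by move=> ?; apply/esym/le_anti.
by move=> ->; rewrite lexx.
Qed.

Lemma Emb_Emb_delta d X f : (0 <= d)%R -> Emb X f -> Emb_delta d X f.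
Proof. by move=> d0 /Emb_delta0; exact: Emb_delta_le. Qed.

Lemma Isom_delta0 T : Isom_delta 0%R T <-> Isom T.
Proof. by split=> -[/Emb_delta0]. Qed.

Lemma Isom_id : Isom (id : E -> E).
Proof. by split; [exact: Emb_id|exact: image_id]. Qed.

Lemma Isom_delta_le d e T : (0 <= d)%R -> (d <= e)%R -> Isom_delta d T -> Isom_delta e T.
Proof. by move=> d0 de [eT sT]; split=> //; exact: Emb_delta_le eT. Qed.

Lemma Isom_delta_lipschitz d T x y : Isom_delta d T ->
  (rnorm (T x - T y) <= (1 + d) * rnorm (x - y))%R.
Proof. by move=> [[lT nT] _]; rewrite -linear_onB//; have /andP[_] := nT (x - y)%R I. Qed.

(** Distortion factors [1 + d] and [1 + e] multiply; the parameter is their product minus one. *)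
Lemma Isom_delta_comp d e T U : (0 <= d)%R -> (0 <= e)%R ->
  Isom_delta d T -> Isom_delta e U ->
  Isom_delta ((1 + d) * (1 + e) - 1)%R (U \o T).
Proof.
move=> d0 e0 [/(Emb_deltaP _ _ d0)[lT nT] sT] [/(Emb_deltaP _ _ e0)[lU nU] sU].
split; last by rewrite -image_comp sT.
apply/Emb_deltaP; first by nra.
split=> [a x y _ _|x _]; first by rewrite /= lT// lU.
have [T1 T2] := nT _ (I : setT x); have [U1 U2] := nU _ (I : setT (T x)).
rewrite addrC subrK; split.
  by apply: le_trans T1 _; rewrite -mulrA ler_wpM2l// addr_ge0.
by apply: le_trans U2 _; rewrite mulrAC [leRHS]mulrC ler_wpM2l// ?addr_ge0// mulrC.
Qed.

(** The lower norm bound makes [T] injective, and the two bounds of [Emb_deltaP] exchange roles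
    under inversion, so the parameter stays [d]. *)
Lemma Isom_delta_inv d T : (0 <= d)%R -> Isom_delta d T ->
  exists2 V, Isom_delta d V & cancel T V.
Proof.
move=> d0 [/(Emb_deltaP _ _ d0)[lT nT] sT].
have /choice[V TV] : forall y, exists x, T x = y.
  by move=> y; have [x _ <-] : (T @` setT) y by [rewrite sT]; exists x.
have injT : injective T.
  move=> x y Txy; apply/subr0_eq/rnorm0_eq0/le_anti; rewrite rnorm_ge0 andbT.
  have [+ _] := nT (x - y)%R I.
  by rewrite linear_onB// Txy subrr rnorm0 mulr0.
have TK : cancel T V by move=> x; exact/injT.
exists V => //; split; last first.
  by apply/seteqP; split=> // x _; exists (T x).
apply/Emb_deltaP => //; split=> [a x y _ _|y _].
  by apply: injT; rewrite lT// !TV.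
by have [] := nT (V y) I; rewrite TV.
Qed.

Lemma Isom_comp T U : Isom T -> Isom U -> Isom (U \o T).
Proof.
move=> /Isom_delta0 hT /Isom_delta0 hU; apply/Isom_delta0.
have := Isom_delta_comp (lexx _) (lexx _) hT hU.
by rewrite !addr0 mulr1 subrr.
Qed.

(** Reconciles [gamma] and [DE], stated with balls of images, with [d_delta] and [D_delta], stated
    with images of balls. *)
Lemma unit_ball_image X f : Emb X f -> unit_ball (f @` X) = f @` unit_ball X.
Proof.
move=> [_ nf]; apply/seteqP; split.
  by move=> _ [[x Xx <-]]; rewrite /= nf// => x1; exists x.
by move=> _ [x [Xx x1] <-]; split; [exists x|rewrite /= nf].
Qed.

(** The origin lies in both balls, at distance at most 1 from each of their points. *)
Lemma hclose_unit_ball X Y : Age E X -> Age E Y ->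
  hclose 1%R (unit_ball X) (unit_ball Y).
Proof.
move=> aX aY; split=> x [_ x1]; exists 0%R; rewrite ?subr0//; try exact: unit_ball0.
by rewrite rdistC subr0.
Qed.

Lemma opdist_lt e X f g x : opdist X f g < e%:E -> unit_ball X x ->
  (rnorm (f x - g x) <= e)%R.
Proof.
move=> /ltW fg Xx; rewrite -lee_fin; apply: le_trans fg.
by apply: ereal_sup_ubound; exists x.
Qed.

(** * Passing between the infima and pairs of maps with close images *)

Lemma d_delta_le d r X Y t u : Emb_delta d X t -> Emb_delta d Y u ->
  hclose r (t @` unit_ball X) (u @` unit_ball Y) -> d_delta d X Y <= r%:E.
Proof.
move=> ht hu tu; apply: ge_ereal_inf; eexists; last exact: hausdorff_dist_le tu.
by exists t => //; exists u.
Qed.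

Lemma d_delta_lt d r X Y : d_delta d X Y < r%:E -> exists t u,
  [/\ Emb_delta d X t, Emb_delta d Y u &
      hclose r (t @` unit_ball X) (u @` unit_ball Y)].
Proof.
move=> /ereal_inf_lt[_ [t ht [u hu <-]] /hausdorff_dist_lt tu].
by exists t, u.
Qed.

Lemma D_delta_le d r X Y T U : Isom_delta d T -> Isom_delta d U ->
  hclose r (T @` unit_ball X) (U @` unit_ball Y) -> D_delta d X Y <= r%:E.
Proof.
move=> hT hU TU; apply: ge_ereal_inf; eexists; last exact: hausdorff_dist_le TU.
by exists T => //; exists U.
Qed.

Lemma D_delta_lt d r X Y : D_delta d X Y < r%:E -> exists T U,
  [/\ Isom_delta d T, Isom_delta d U &
      hclose r (T @` unit_ball X) (U @` unit_ball Y)].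
Proof.
move=> /ereal_inf_lt[_ [T hT [U hU <-]] /hausdorff_dist_lt TU].
by exists T, U.
Qed.

Lemma gamma_lt r X Y : gamma X Y < r%:E -> exists t u,
  [/\ Emb X t, Emb Y u & hclose r (t @` unit_ball X) (u @` unit_ball Y)].
Proof.
move=> /ereal_inf_lt[_ [_ [_ [t ht <-]] [_ [_ [u hu <-]] <-]] /hausdorff_dist_lt].
by rewrite !unit_ball_image// => tu; exists t, u.
Qed.

Lemma DE_lt r X Y : DE X Y < r%:E ->
  exists2 T, Isom T & hclose r (T @` unit_ball X) (unit_ball Y).
Proof.
move=> /ereal_inf_lt[_ [T hT <-] /hausdorff_dist_lt].
rewrite unit_ball_image; first by exists T.
by case: hT => hT _; exact: Emb_sub hT.
Qed.

Lemma DE_le r X Y T : Isom T -> hclose r (T @` unit_ball X) (unit_ball Y) ->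
  DE X Y <= r%:E.
Proof.
move=> hT TXY; apply: ge_ereal_inf; eexists; first by exists T.
rewrite unit_ball_image; first exact: hausdorff_dist_le.
by case: hT => hT _; exact: Emb_sub hT.
Qed.

(** * Inequalities valid in every Banach space *)

Lemma gamma_a_le_gamma X Y : gamma_a X Y <= gamma X Y.
Proof.
apply: ge_ereal_sup => _ [d /= d0 <-]; apply: lee_real_gt => r.
move=> /gamma_lt[t [u [ht hu tu]]].
by apply: d_delta_le tu; exact: Emb_Emb_delta (ltW d0) _.
Qed.

Lemma gamma_le_DE X Y : Age E X -> Age E Y -> gamma X Y <= DE X Y.
Proof.
move=> aX aY; apply: le_ereal_inf_tmp => _ [T [hT _] <-].
apply: ge_ereal_inf; eexists; last exact: lexx.
(* The image of [X] under [T], paired with [Y] itself, competes in the infimum [gamma]. *)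
exists (T @` X).
  split; first by apply: Age_image => //; case: hT.
  by exists T => //; exact: Emb_sub hT.
by exists Y => //; split=> //; exists id; [exact: Emb_id|exact: image_id].
Qed.

Lemma gamma_a_le_DE_a X Y : gamma_a X Y <= DE_a X Y.
Proof.
apply: ge_ereal_sup => _ [d d0 <-].
apply: (@le_trans _ _ (D_delta d X Y)); last by apply: ereal_sup_ubound; exists d.
apply: lee_real_gt => r /D_delta_lt[T [U [[hT _] [hU _] TU]]].
by apply: d_delta_le TU; [exact: Emb_delta_sub hT|exact: Emb_delta_sub hU].
Qed.

Lemma DE_a_le_DE X Y : DE_a X Y <= DE X Y.
Proof.
apply: ge_ereal_sup => _ [d /= /ltW d0 <-]; apply: lee_real_gt => r.
move=> /DE_lt[T /Isom_delta0 hT TXY].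
apply: (@D_delta_le _ _ _ _ T id); last by rewrite image_id.
  exact: Isom_delta_le hT.
by apply: (@Isom_delta_le 0%R) => //; apply/Isom_delta0/Isom_id.
Qed.

(** * Bounds, diagonal and symmetry *)

Lemma DE_le1 X Y : Age E X -> Age E Y -> DE X Y <= 1.
Proof.
by move=> aX aY; apply: (DE_le Isom_id); rewrite image_id; exact: hclose_unit_ball.
Qed.

Lemma gamma_a_ge0 X Y : Age E X -> 0 <= gamma_a X Y.
Proof.
(* The supremum dominates each positive level, so one of them is enough; 1 is an arbitrary
   choice. *)
move=> aX; apply: (@le_trans _ _ (d_delta 1%R X Y)); last first.
  by apply: ereal_sup_ubound; exists 1%R => //=; exact: ltr01.
apply: le_ereal_inf_tmp => _ [t _ [u _ <-]]; apply: hausdorff_dist_ge0.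
by exists (t 0%R); exists 0%R => //; exact: unit_ball0.
Qed.

Lemma DExx_le0 X : DE X X <= 0.
Proof.
apply: (DE_le Isom_id); rewrite image_id; split=> x Xx; exists x => //;
  by rewrite subrr rnorm0.
Qed.

Lemma gammaC X Y : gamma X Y = gamma Y X.
Proof.
wlog suff: X Y / gamma X Y <= gamma Y X by move=> h; apply/le_anti; rewrite !h.
apply: le_ereal_inf_tmp => _ [Y0 hY [X0 hX <-]]; rewrite hausdorff_distC.
by apply: ereal_inf_lbound; exists X0 => //; exists Y0.
Qed.

Lemma gamma_aC X Y : gamma_a X Y = gamma_a Y X.
Proof.
wlog suff: X Y / gamma_a X Y <= gamma_a Y X by move=> h; apply/le_anti; rewrite !h.
apply: ge_ereal_sup => _ [d d0 <-].
apply: (@le_trans _ _ (d_delta d Y X)); last by apply: ereal_sup_ubound; exists d.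
apply: lee_real_gt => r /d_delta_lt[t [u [ht hu /hclose_sym tu]]].
exact: d_delta_le tu.
Qed.

(** * Triangle inequalities for the two distances built from surjective maps *)

Lemma D_delta_antitone d e X Y : (0 <= d)%R -> (d <= e)%R ->
  D_delta e X Y <= D_delta d X Y.
Proof.
move=> d0 de; apply: lee_real_gt => r /D_delta_lt[T [U [hT hU TU]]].
by apply: D_delta_le TU; exact: Isom_delta_le de _.
Qed.

(** Near-optimal isometries for the two terms compose, and the second one transports the first
    estimate without loss. *)
Lemma DE_triangle X Y Z : Age E X -> Age E Y -> Age E Z ->
  DE X Z <= DE X Y + DE Y Z.
Proof.
have DEfin X' Y' : Age E X' -> Age E Y' -> DE X' Y' \is a fin_num.
  move=> aX aY; rewrite ge0_fin_numE; first exact: le_lt_trans (DE_le1 aX aY) (ltry _).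
  apply: le_trans (gamma_a_ge0 _ aX) _.
  exact: le_trans (gamma_a_le_gamma _ _) (gamma_le_DE aX aY).
move=> aX aY aZ; apply/lee_addgt0Pr => e e0.
rewrite -(fineK (DEfin _ _ aX aY)) -(fineK (DEfin _ _ aY aZ)) -!EFinD.
have /DE_lt[T hT TXY] : DE X Y < (fine (DE X Y) + e / 2)%:E.
  by rewrite EFinD fineK ?DEfin// lteDl ?DEfin// lte_fin divr_gt0.
have /DE_lt[U hU UYZ] : DE Y Z < (fine (DE Y Z) + e / 2)%:E.
  by rewrite EFinD fineK ?DEfin// lteDl ?DEfin// lte_fin divr_gt0.
apply: (DE_le (Isom_comp hT hU)); rewrite -image_comp.
(* The factor [1 + 0] is the Lipschitz constant of [U] viewed in [Isom_delta 0]. *)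
have -> : (fine (DE X Y) + fine (DE Y Z) + e =
    (1 + 0) * (fine (DE X Y) + e / 2) + (fine (DE Y Z) + e / 2))%R.
  by field.
apply: hclose_trans UYZ; apply: hclose_lipschitz TXY; first by rewrite addr0.
by move=> x y; apply: Isom_delta_lipschitz; exact/Isom_delta0.
Qed.

(* If T B_X is close to U B_Y and V B_Y to W B_Z, then V U^-1 T B_X is close to
   V B_Y, hence to W B_Z. *)
Lemma D_delta_triangle d r s X Y Z : (0 <= d)%R ->
  D_delta d X Y < r%:E -> D_delta d Y Z < s%:E ->
  D_delta ((1 + d) ^+ 3 - 1)%R X Z <= ((1 + d) ^+ 2 * r + s)%:E.
Proof.
move=> d0 /D_delta_lt[T [U [hT hU TU]]] /D_delta_lt[V [W [hV hW VW]]].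
have [U' hU' UK] := Isom_delta_inv d0 hU.
have hP := Isom_delta_comp d0 d0 hU' hV.
have dd0 : (0 <= (1 + d) * (1 + d) - 1)%R by nra.
have := Isom_delta_comp d0 dd0 hT hP.
(* [T], [U'] and [V] each contribute a factor [1 + d], whence the cube; the estimate itself is
   carried by [V \o U'] alone, whence the square in front of [r]. *)
rewrite [(1 + (_ - 1))%R]addrC subrK -expr2 -exprS => hPT.
apply: (@D_delta_le _ _ _ _ ((V \o U') \o T) W) => //.
  by apply: Isom_delta_le hW => //; rewrite !exprS expr0; nra.
apply: (@hclose_trans _ _ _ _ _ _ (V @` unit_ball Y)) => //.
have -> : V @` unit_ball Y = (V \o U') @` (U @` unit_ball Y).
  by rewrite image_comp; apply: eq_imagel => y _ /=; rewrite UK.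
rewrite -[((V \o U') \o T) @` _]image_comp.
apply: hclose_lipschitz TU; first by rewrite exprn_ge0// addr_ge0.
move=> x y; have := Isom_delta_lipschitz x y hP.
by rewrite [(1 + (_ - 1))%R]addrC subrK -expr2.
Qed.

(** The losses in [D_delta_triangle] vanish as [d] tends to 0; since [DE_a] is at most 1, its
    multiplicative loss becomes a small additive one. *)
Lemma DE_a_triangle X Y Z : Age E X -> Age E Y -> Age E Z ->
  DE_a X Z <= DE_a X Y + DE_a Y Z.
Proof.
have DE_a1 X' Y' : Age E X' -> Age E Y' -> DE_a X' Y' <= 1.
  by move=> aX aY; exact: le_trans (DE_a_le_DE _ _) (DE_le1 aX aY).
have DEfin X' Y' : Age E X' -> Age E Y' -> DE_a X' Y' \is a fin_num.
  move=> aX aY; rewrite ge0_fin_numE; first exact: le_lt_trans (DE_a1 _ _ aX aY) (ltry _).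
  exact: le_trans (gamma_a_ge0 _ aX) (gamma_a_le_DE_a _ _).
move=> aX aY aZ; apply: ge_ereal_sup => _ [d0 /= d0_gt0 <-].
apply/lee_addgt0Pr => e e0.
have := DE_a1 _ _ aX aY.
rewrite -(fineK (DEfin _ _ aX aY)) -(fineK (DEfin _ _ aY aZ)) -!EFinD lee_fin.
pose a := fine (DE_a X Y); pose b := fine (DE_a Y Z).
rewrite -/a -/b => a1.
pose e' : R := Num.min 1%R (e / 4)%R.
(* For [d <= 1] one has [(1 + d)^3 - 1 <= 7 d <= d0] and [(1 + d)^2 <= 1 + 3 d]. With [a] and [e']
   at most 1, the total excess is at most [2 e' + 6 d <= e]. *)
pose d : R := Num.min (Num.min 1%R (d0 / 7)%R) (e / 12)%R.
have e'0 : (0 < e')%R by rewrite lt_min ltr01 divr_gt0.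
have e'1 : (e' <= 1)%R by rewrite ge_min lexx.
have e'e : (e' <= e / 4)%R by rewrite ge_min lexx orbT.
have d_gt0 : (0 < d)%R by rewrite !lt_min ltr01 !divr_gt0.
have d1 : (d <= 1)%R by rewrite !ge_min lexx.
have dd0 : (d <= d0 / 7)%R by rewrite !ge_min lexx orbT.
have de : (d <= e / 12)%R by rewrite !ge_min lexx orbT.
have Dlt X' Y' : Age E X' -> Age E Y' ->
    D_delta d X' Y' < (fine (DE_a X' Y') + e')%:E.
  move=> aX' aY'; apply: (@le_lt_trans _ _ (DE_a X' Y')).
    by apply: ereal_sup_ubound; exists d.
  by rewrite EFinD fineK ?DEfin// lteDl ?DEfin// lte_fin.
have := D_delta_triangle (ltW d_gt0) (Dlt _ _ aX aY) (Dlt _ _ aY aZ).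
rewrite -/a -/b => DXZ.
have dd : (d * d <= d)%R by nra.
apply: le_trans (D_delta_antitone _ _ _ _) (le_trans DXZ _).
- by rewrite !exprS expr0; nra.
- by rewrite !exprS expr0; nra.
- rewrite lee_fin; have : ((1 + d) ^+ 2 <= 1 + 3 * d)%R by nra.
  have a0 : (0 <= a)%R.
    apply: fine_ge0; exact: le_trans (gamma_a_ge0 _ aX) (gamma_a_le_DE_a _ _).
  by nra.
Qed.

(** * Reverse inequalities from homogeneity, and a criterion for pseudometrics *)

Lemma DE_a_le_gamma X Y : almost_ultrahomogeneous E -> Age E X -> Age E Y ->
  DE_a X Y <= gamma X Y.
Proof.
move=> AU aX aY; apply: ge_ereal_sup => _ [d d0 <-]; apply: lee_real_gt => r.
move=> /gamma_lt[t [u [ht hu tu]]].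
have [T hT Tt] := AU _ _ _ d0 aX ht; have [U hU Uu] := AU _ _ _ d0 aY hu.
apply: (D_delta_le hT hU).
rewrite (@eq_imagel _ _ _ T t); last by move=> x [/Tt].
by rewrite (@eq_imagel _ _ _ U u)// => x [/Uu].
Qed.

Lemma weak_almost_Fraisse_almost_ultrahomogeneous :
  weak_almost_Fraisse E -> almost_ultrahomogeneous E.
Proof.
move=> wF e X phi e0 aX hphi; have [d d0] := wF _ _ aX e0.
by apply; exact: Emb_Emb_delta (ltW d0) hphi.
Qed.

Lemma DE_a_le_gamma_a X Y : weak_almost_Fraisse E -> Age E X -> Age E Y ->
  DE_a X Y <= gamma_a X Y.
Proof.
move=> wF aX aY; apply: ge_ereal_sup => _ [e e0 <-].
have [dX dX0 hX] := wF _ _ aX e0; have [dY dY0 hY] := wF _ _ aY e0.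
(* The minimum lets maps on [X] and on [Y] both be extended with the same [e]. *)
pose d := Num.min dX dY; have d0 : (0 < d)%R by rewrite lt_min dX0.
apply: (@le_trans _ _ (d_delta d X Y)); last by apply: ereal_sup_ubound; exists d.
apply: lee_real_gt => r /d_delta_lt[t [u [ht hu tu]]].
have /hX[T hT Tt] : Emb_delta dX X t.
  by apply: (Emb_delta_le (ltW d0)) ht; rewrite ge_min lexx.
have /hY[U hU Uu] : Emb_delta dY Y u.
  by apply: (Emb_delta_le (ltW d0)) hu; rewrite ge_min lexx orbT.
apply: (D_delta_le hT hU).
rewrite (@eq_imagel _ _ _ T t); last by move=> x [/Tt].
by rewrite (@eq_imagel _ _ _ U u)// => x [/Uu].
Qed.

(** The ball of [X] moved by [T] is reached from that of [Y] moved by [U] through the images under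
    [t] and [u], at cost [e + r + e]. Applying the inverse of [U] brings this to the one-sided form
    of [DE]. *)
Lemma DE_le_approx r e X Y t u T U : Isom T -> Isom U ->
  opdist X T t < e%:E -> opdist Y U u < e%:E ->
  hclose r (t @` unit_ball X) (u @` unit_ball Y) -> DE X Y <= (e + r + e)%:E.
Proof.
move=> hT hU Tt Uu tu.
have [V /Isom_delta0 hV UK] := Isom_delta_inv (lexx _) (iffRL (Isom_delta0 U) hU).
apply: (DE_le (Isom_comp hT hV)); rewrite -image_comp.
have -> : unit_ball Y = V @` (U @` unit_ball Y).
  by rewrite image_comp (@eq_imagel _ _ _ _ id) ?image_id// => y _ /=; rewrite UK.
rewrite -[(e + r + e)%R]mul1r; apply: hclose_lipschitz => //.
  move=> x y; rewrite -[1%R]addr0; apply: Isom_delta_lipschitz; exact/Isom_delta0.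
apply: (@hclose_trans _ _ _ _ _ _ (u @` unit_ball Y)); last first.
  by apply/hclose_sym/hclose_image => y; exact: opdist_lt.
by apply: hclose_trans tu; apply: hclose_image => x; exact: opdist_lt.
Qed.

Lemma DE_le_gamma X Y : approximately_ultrahomogeneous E -> Age E X -> Age E Y ->
  DE X Y <= gamma X Y.
Proof.
move=> AU aX aY; apply: lee_real_gt => r /gamma_lt[t [u [ht hu tu]]].
apply/lee_addgt0Pr => e e0; have e20 : (0 < e / 2)%R by rewrite divr_gt0.
(* Taking the inclusion of [X] as first embedding makes [T] itself approximate [t]; likewise for [U]
   and [u]. *)
have [T hT Tt] := AU _ _ _ _ e20 aX (Emb_id X) ht.
have [U hU Uu] := AU _ _ _ _ e20 aY (Emb_id Y) hu.
apply: le_trans (DE_le_approx hT hU Tt Uu tu) _.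
by rewrite -EFinD lee_fin; lra.
Qed.

Lemma DE_le_gamma_a X Y : weak_Fraisse E -> Age E X -> Age E Y ->
  DE X Y <= gamma_a X Y.
Proof.
move=> wF aX aY.
apply/lee_addgt0Pr => e e0; have e20 : (0 < e / 2)%R by rewrite divr_gt0.
have [dX dX0 hX] := wF _ _ e20 aX; have [dY dY0 hY] := wF _ _ e20 aY.
pose d := Num.min dX dY; have d0 : (0 < d)%R by rewrite lt_min dX0.
apply: (@le_trans _ _ (d_delta d X Y + e%:E)); last first.
  by apply: leeD2r; apply: ereal_sup_ubound; exists d.
(* Moving [e] to the left leaves the infimum alone on the right, where reals above it give pairs of
   maps. *)
rewrite -leeBlDr//; apply: lee_real_gt => r /d_delta_lt[t [u [ht hu tu]]].
have htX : Emb_delta dX X t.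
  by apply: (Emb_delta_le (ltW d0)) ht; rewrite ge_min lexx.
have huY : Emb_delta dY Y u.
  by apply: (Emb_delta_le (ltW d0)) hu; rewrite ge_min lexx orbT.
have [T hT Tt] := hX _ _ (Emb_Emb_delta (ltW dX0) (Emb_id X)) htX.
have [U hU Uu] := hY _ _ (Emb_Emb_delta (ltW dY0) (Emb_id Y)) huY.
rewrite leeBlDr//; apply: le_trans (DE_le_approx hT hU Tt Uu tu) _.
by rewrite -EFinD lee_fin; lra.
Qed.

(** Finiteness, positivity and the zero diagonal follow from the position of [rho] between [gamma_a]
    and [DE]. The triangle inequality is borrowed from [D], whose surjective maps can be composed:
    [DE_a] serves for [gamma_a], and [DE] for [gamma]. *)
Lemma pseudometric_on_between (rho D : set E -> set E -> \bar R) :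
  (forall X Y, rho X Y = rho Y X) ->
  (forall X Y, Age E X -> Age E Y -> gamma_a X Y <= rho X Y <= DE X Y) ->
  (forall X Y, Age E X -> Age E Y -> rho X Y = D X Y) ->
  (forall X Y Z, Age E X -> Age E Y -> Age E Z -> D X Z <= D X Y + D Y Z) ->
  pseudometric_on (Age E) rho.
Proof.
move=> rhoC rho_bnd rhoD D_tri.
have rho0 X Y : Age E X -> Age E Y -> 0 <= rho X Y.
  by move=> aX aY; have /andP[+ _] := rho_bnd _ _ aX aY; exact: le_trans (gamma_a_ge0 _ aX).
split=> //.
- move=> X Y aX aY; split; last exact: rho0.
  rewrite ge0_fin_numE ?rho0//; have /andP[_ rho1] := rho_bnd _ _ aX aY.
  exact: le_lt_trans (le_trans rho1 (DE_le1 aX aY)) (ltry _).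
- move=> X aX; have /andP[_ rho1] := rho_bnd _ _ aX aX.
  by apply/le_anti; rewrite rho0// andbT; exact: le_trans rho1 (DExx_le0 X).
- by move=> X Y Z aX aY aZ; rewrite !rhoD//; exact: D_tri.
Qed.

End Maps.

Theorem proposition4p15 (R : realType) (k : scalar_kind)
    (E : completeNormedModType (scalars R k)) (X Y : set E)
    (ageX : Age E X) (ageY : Age E Y) :
  [/\ (* (1) *)
      (gamma_a X Y <= gamma X Y /\ gamma X Y <= DE X Y) /\
      (gamma_a X Y <= DE_a X Y /\ DE_a X Y <= DE X Y),
      (* (2) *)
      almost_ultrahomogeneous E ->
      [/\ gamma_a X Y <= DE_a X Y, DE_a X Y <= gamma X Y
        & gamma X Y <= DE X Y],
      (* (3) *)
      weak_almost_Fraisse E ->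
      [/\ gamma_a X Y = DE_a X Y, DE_a X Y <= gamma X Y,
          gamma X Y <= DE X Y
        & pseudometric_on (Age E) (@gamma_a R k E)],
      (* (4) *)
      approximately_ultrahomogeneous E ->
      [/\ gamma_a X Y <= DE_a X Y, DE_a X Y <= gamma X Y,
          gamma X Y = DE X Y
        & pseudometric_on (Age E) (@gamma R k E)]
    & (* (5) *)
      weak_Fraisse E ->
      forall X' Y' : set E, Age E X' -> Age E Y' ->
      [/\ gamma_a X' Y' = gamma X' Y', gamma X' Y' = DE_a X' Y'
        & DE_a X' Y' = DE X' Y']].
Proof.
have gD X' Y' (aX : Age E X') (aY : Age E Y') := gamma_le_DE aX aY.
have gag (X' Y' : set E) : gamma_a X' Y' <= gamma X' Y' := gamma_a_le_gamma X' Y'.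
have gaDa (X' Y' : set E) : gamma_a X' Y' <= DE_a X' Y' := gamma_a_le_DE_a X' Y'.
have DaD (X' Y' : set E) : DE_a X' Y' <= DE X' Y' := DE_a_le_DE X' Y'.
split.
- by split; split=> //; exact: gD.
- by move=> AU; split=> //; [exact: DE_a_le_gamma|exact: gD].
- move=> wF.
  have gaE X' Y' : Age E X' -> Age E Y' -> gamma_a X' Y' = DE_a X' Y'.
    by move=> aX aY; apply/le_anti; rewrite gaDa DE_a_le_gamma_a.
  split; [exact: gaE| |exact: gD|].
    by apply: DE_a_le_gamma => //; exact: weak_almost_Fraisse_almost_ultrahomogeneous.
  apply: (pseudometric_on_between (@gamma_aC _ _ E) _ gaE (@DE_a_triangle _ _ E)).
  by move=> X' Y' aX aY; rewrite lexx (le_trans (gag _ _)) ?gD.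
- move=> AU.
  have gE X' Y' : Age E X' -> Age E Y' -> gamma X' Y' = DE X' Y'.
    by move=> aX aY; apply/le_anti; rewrite gD// DE_le_gamma.
  (* Here [DE_a <= gamma] holds because [gamma] equals [DE], which always dominates [DE_a]. *)
  split; [exact: gaDa|by rewrite gE|exact: gE|].
  apply: (pseudometric_on_between (@gammaC _ _ E) _ gE (@DE_triangle _ _ E)).
  by move=> X' Y' aX aY; rewrite gag gD.
- move=> wF X' Y' aX aY; have Dga := DE_le_gamma_a wF aX aY.
  (* Both chains of (1) run from [gamma_a] to [DE], so equality of these two ends collapses them. *)
  have gE : gamma_a X' Y' = DE X' Y'.
    by apply/le_anti; rewrite Dga (le_trans (gag _ _)) ?gD.
  have -> : gamma X' Y' = DE X' Y'.
    by apply/le_anti; rewrite gD// -gE gag.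
  have -> // : DE_a X' Y' = DE X' Y'.
  by apply/le_anti; rewrite DaD -gE gaDa.
Qed.
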